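(* Let $r$ be a prime number, $a\in\mathbb{Z}_{\ge1}$, $e=r^a$, let $\zeta\in\mathbb{C}$ be a primitive $e$-th root of unity, and let $\mathfrak p=(1-\zeta)\subset\mathbb{Z}[\zeta]$, so $\mathbb{Z}[\zeta]/\mathfrak p\cong\mathbb{F}_r$. Let $M,N$ be $H^\Lambda_{n,\zeta}(\mathbb{Z}[\zeta])$-modules, and put $M_{\mathbb{C}}=\mathbb{C}\otimes_{\mathbb{Z}[\zeta]}M$, $M_{\mathbb{F}_r}=M/\mathfrak pM$, and similarly for $N$. Suppose that $\mathrm{Hom}_{H^\Lambda_{n,\zeta}(\mathbb{C})}(M_{\mathbb{C}},N_{\mathbb{C}})\neq\{0\}$. Then $\mathrm{Hom}_{H^\Lambda_{n,1}(\mathbb{F}_r)}(M_{\mathbb{F}_r},N_{\mathbb{F}_r})\ne\{0\}$.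
   Context: Let $R$ be a commutative ring, $v\in R$ invertible, and for $m\in\mathbb{Z}_{\geq0}$ let $[m]_v=v+v^3+\dots+v^{2m-1}$. Fix $n,\ell\ge1$ and a multicharge $\kappa=(\kappa_1,\dots,\kappa_\ell)\in(\mathbb{Z}/e\mathbb{Z})^\ell$, represented by integers in $\{0,\dots,e-1\}$; $\Lambda=\Lambda(\kappa)$ records this choice. The integral cyclotomic Hecke algebra $H^\Lambda_{n,v}(R)$ is the $R$-algebra with generators $L_1,\dots,L_n,T_1,\dots,T_{n-1}$ and relations $\prod_{i=1}^\ell(L_1-Q_i)=0$ with $Q_i=[\kappa_i]_v$; $(T_s+v^{-1})(T_s-v)=0$; $L_{s+1}=T_sL_sT_s+T_s$; $L_sL_t=L_tL_s$; $T_sT_t=T_tT_s$ if $|s-t|\ge2$; $T_sT_{s+1}T_s=T_{s+1}T_sT_{s+1}$; $T_sL_t=L_tT_s$ if $t\ne s,s+1$. The ring map $\mathbb{Z}[\zeta]\to\mathbb{F}_r$, $\zeta\mapsto1$, identifies $H^\Lambda_{n,\zeta}(\mathbb{Z}[\zeta])/\mathfrak pH^\Lambda_{n,\zeta}(\mathbb{Z}[\zeta])$ with $H^\Lambda_{n,1}(\mathbb{F}_r)$ (parameters $v=1$ and $Q_i=\kappa_i\bmod r$), so $M_{\mathbb{F}_r}$ is an $H^\Lambda_{n,1}(\mathbb{F}_r)$-module.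
   Formalization: For arbitrary modules the claim fails (e.g. n=ℓ=1, κ=0, M=ℤ[ζ], N=ℚ(ζ): N/𝔭N=0); the formal theorem assumes that M and N are finitely generated over ℤ[ζ] and that N is torsion-free over ℤ[ζ]. *)

(* Defs.v *)
From HB Require Import structures.
From mathcomp Require Import all_boot all_order all_algebra.
From mathcomp Require Import generic_quotient boolp reals complex.

Set Implicit Arguments.
Unset Strict Implicit.
Unset Printing Implicit Defensive.

Import GRing.Theory.
Local Open Scope ring_scope.
Local Open Scope quotient_scope.

(** [palg rels] is the R-algebra with generators [G] and relations [rels]: formal
  noncommutative polynomial expressions modulo the least congruence that
  contains the algebra axioms and [rels]. It may be the zero ring, so it is only
  a [pzRingType]; its R-algebra structure is the central map [pcst]. *)

Declare Scope pexpr_scope.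
Delimit Scope pexpr_scope with X.

Inductive pexpr (R G : Type) : Type :=
| PCst of R
| PGen of G
| PAdd of pexpr R G & pexpr R G
| PMul of pexpr R G & pexpr R G.
Arguments PCst {R G}.
Arguments PGen {R G}.
Arguments PAdd {R G}.
Arguments PMul {R G}.
Bind Scope pexpr_scope with pexpr.
Notation "x + y" := (PAdd x y) : pexpr_scope.
Notation "x * y" := (PMul x y) : pexpr_scope.

HB.instance Definition _ (R G : Type) := gen_eqMixin (pexpr R G).
HB.instance Definition _ (R G : Type) := gen_choiceMixin (pexpr R G).

Inductive palg_eq (R : comPzRingType) (G : Type)
  (rels : pexpr R G -> pexpr R G -> Prop) : pexpr R G -> pexpr R G -> Prop :=
| pe_rel x y : rels x y -> palg_eq rels x y
| pe_refl x : palg_eq rels x x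
| pe_sym x y : palg_eq rels x y -> palg_eq rels y x
| pe_trans x y z : palg_eq rels x y -> palg_eq rels y z -> palg_eq rels x z
| pe_add x x' y y' : palg_eq rels x x' -> palg_eq rels y y' ->
    palg_eq rels (x + y) (x' + y')
| pe_mul x x' y y' : palg_eq rels x x' -> palg_eq rels y y' ->
    palg_eq rels (x * y) (x' * y')
| pe_addA x y z : palg_eq rels (x + (y + z)) (x + y + z)
| pe_addC x y : palg_eq rels (x + y) (y + x)
| pe_add0 x : palg_eq rels (PCst 0 + x) x
| pe_addN x : palg_eq rels (PCst (- 1) * x + x) (PCst 0)
| pe_mulA x y z : palg_eq rels (x * (y * z)) (x * y * z)
| pe_mul1 x : palg_eq rels (PCst 1 * x) x
| pe_mulDl x y z : palg_eq rels ((x + y) * z) (x * z + y * z)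
| pe_mulDr x y z : palg_eq rels (x * (y + z)) (x * y + x * z)
| pe_cstD a b : palg_eq rels (PCst (a + b)%R) (PCst a + PCst b)
| pe_cstM a b : palg_eq rels (PCst (a * b)%R) (PCst a * PCst b)
| pe_central a x : palg_eq rels (PCst a * x) (x * PCst a).

Section PresentedAlgebra.
Variables (R : comPzRingType) (G : Type).
Variable rels : pexpr R G -> pexpr R G -> Prop.

Definition palg_eqb : rel (pexpr R G) := fun x y => `[< palg_eq rels x y >].

Fact palg_eqb_equiv : equiv_class_of palg_eqb.
Proof.
split=> [x|x y|y x z]; first exact/asboolP/pe_refl.
  by apply/asboolP/asboolP; apply: pe_sym.
by move=> /asboolP xy /asboolP yz; apply/asboolP; apply: pe_trans xy yz.
Qed.
Canonical palg_equiv := EquivRelPack palg_eqb_equiv.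

Definition palg : Type := {eq_quot palg_equiv}.
HB.instance Definition _ := Choice.on palg.
HB.instance Definition _ := Quotient.on palg.
HB.instance Definition _ := EqQuotient.on palg.

Lemma palgP (x y : pexpr R G) : palg_eq rels x y <-> \pi_palg x = \pi_palg y.
Proof. by split=> [xy|/eqmodP/asboolP//]; apply/eqmodP/asboolP. Qed.

Lemma palg_reprK (x : pexpr R G) : palg_eq rels (repr (\pi_palg x)) x.
Proof. by apply/palgP; rewrite reprK. Qed.

Definition palg_add (x y : palg) : palg := \pi_palg (repr x + repr y)%X.
Definition palg_mul (x y : palg) : palg := \pi_palg (repr x * repr y)%X.
Definition palg_opp (x : palg) : palg := \pi_palg (PCst (- 1) * repr x)%X.
Definition pcst (a : R) : palg := \pi_palg (PCst a).
Definition pgen (g : G) : palg := \pi_palg (PGen g).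

Lemma palg_addE x y : palg_add (\pi x) (\pi y) = \pi_palg (x + y)%X.
Proof. by apply/palgP/pe_add; apply: palg_reprK. Qed.
Lemma palg_mulE x y : palg_mul (\pi x) (\pi y) = \pi_palg (x * y)%X.
Proof. by apply/palgP/pe_mul; apply: palg_reprK. Qed.
Lemma palg_oppE x : palg_opp (\pi x) = \pi_palg (PCst (- 1) * x)%X.
Proof. by apply/palgP/pe_mul; [apply: pe_refl | apply: palg_reprK]. Qed.

Fact palg_addA : associative palg_add.
Proof.
by elim/quotW=> x; elim/quotW=> y; elim/quotW=> z; rewrite !palg_addE; apply/palgP/pe_addA.
Qed.
Fact palg_addC : commutative palg_add.
Proof. by elim/quotW=> x; elim/quotW=> y; rewrite !palg_addE; apply/palgP/pe_addC. Qed.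
Fact palg_add0 : left_id (pcst 0) palg_add.
Proof. by elim/quotW=> x; rewrite palg_addE; apply/palgP/pe_add0. Qed.
Fact palg_addN : left_inverse (pcst 0) palg_opp palg_add.
Proof. by elim/quotW=> x; rewrite palg_oppE palg_addE; apply/palgP/pe_addN. Qed.
Fact palg_mulA : associative palg_mul.
Proof.
by elim/quotW=> x; elim/quotW=> y; elim/quotW=> z; rewrite !palg_mulE; apply/palgP/pe_mulA.
Qed.
Fact palg_mul1l : left_id (pcst 1) palg_mul.
Proof. by elim/quotW=> x; rewrite palg_mulE; apply/palgP/pe_mul1. Qed.
Fact palg_mul1r : right_id (pcst 1) palg_mul.
Proof.
elim/quotW=> x; rewrite palg_mulE; apply/palgP.
by apply: pe_trans (pe_mul1 _ _); apply/pe_sym/pe_central.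
Qed.
Fact palg_mulDl : left_distributive palg_mul palg_add.
Proof.
elim/quotW=> x; elim/quotW=> y; elim/quotW=> z.
by rewrite !(palg_mulE, palg_addE); apply/palgP/pe_mulDl.
Qed.
Fact palg_mulDr : right_distributive palg_mul palg_add.
Proof.
elim/quotW=> x; elim/quotW=> y; elim/quotW=> z.
by rewrite !(palg_mulE, palg_addE); apply/palgP/pe_mulDr.
Qed.

HB.instance Definition _ := GRing.isPzRing.Build palg
  palg_addA palg_addC palg_add0 palg_addN palg_mulA palg_mul1l palg_mul1r
  palg_mulDl palg_mulDr.

Fact pcst_is_zmod_morphism : zmod_morphism pcst.
Proof.
move=> a b; apply: (canRL (addrK _)).
by rewrite [LHS]palg_addE; apply/palgP/pe_sym; rewrite -{1}(subrK b a); apply: pe_cstD.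
Qed.
Fact pcst_is_monoid_morphism : monoid_morphism pcst.
Proof.
by split=> // a b; rewrite [RHS]palg_mulE; apply/palgP/pe_cstM.
Qed.
HB.instance Definition _ := GRing.isZmodMorphism.Build R palg pcst pcst_is_zmod_morphism.
HB.instance Definition _ :=
  GRing.isMonoidMorphism.Build R palg pcst pcst_is_monoid_morphism.

End PresentedAlgebra.

(** [prep rels V]: operators on [V] indexed by the generators that satisfy the
  relations; [repmod rho] is [V] with the resulting [palg rels]-module structure. *)

Section Representation.
Variables (R : comPzRingType) (G : Type).
Variable rels : pexpr R G -> pexpr R G -> Prop.
Variable V : lmodType R.

Fixpoint pact (rho : G -> {linear V -> V}) (x : pexpr R G) (v : V) : V :=
  match x with
  | PCst a => a *: v
  | PGen g => rho g v
  | PAdd x y => pact rho x v + pact rho y v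
  | PMul x y => pact rho x (pact rho y v)
  end.

Record prep := PRep {
  prep_fun :> G -> {linear V -> V};
  prep_rel : forall x y, rels x y -> pact prep_fun x =1 pact prep_fun y
}.

Variable rho : prep.

Lemma pact_linear x : linear (pact rho x).
Proof.
elim: x => [b|g|x IHx y IHy|x IHx y IHy] a u w /=.
- by rewrite scalerDr !scalerA mulrC.
- exact: linearP.
- by rewrite IHx IHy scalerDr addrACA.
- by rewrite IHy IHx.
Qed.

Lemma pactD x : {morph pact rho x : u w / u + w}.
Proof. by move=> u w; rewrite -{1}[u]scale1r pact_linear scale1r. Qed.

Lemma pactZ x a : {morph pact rho x : u / a *: u}.
Proof.
have p0 : pact rho x 0 = 0.
  by apply: (addIr (pact rho x 0)); rewrite -pactD !add0r.
by move=> u; rewrite -[a *: u]addr0 pact_linear p0 !addr0.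
Qed.

Lemma pact_eq x y : palg_eq rels x y -> pact rho x =1 pact rho y.
Proof.
elim=> {x y} //=.
- by move=> x y /prep_rel.
- by move=> x y _ xy v; rewrite xy.
- by move=> x y z _ xy _ yz v; rewrite xy yz.
- by move=> x x' y y' _ xx' _ yy' v; rewrite xx' yy'.
- by move=> x x' y y' _ xx' _ yy' v; rewrite xx' yy'.
- by move=> x y z v; rewrite addrA.
- by move=> x y v; rewrite addrC.
- by move=> x v; rewrite scale0r add0r.
- by move=> x v; rewrite scaleN1r addNr scale0r.
- by move=> x v; rewrite scale1r.
- by move=> x y z v; rewrite pactD.
- by move=> a b v; rewrite scalerDl.
- by move=> a b v; rewrite scalerA.
- by move=> a x v; rewrite pactZ.
Qed.

Definition repmod of prep : Type := V.
HB.instance Definition _ := GRing.Zmodule.copy (repmod rho) V.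

Definition repmod_scale (h : palg rels) (v : repmod rho) : repmod rho :=
  pact rho (repr h) v.

Lemma repmod_scaleE x v : repmod_scale (\pi x) v = pact rho x v.
Proof. exact/pact_eq/palg_reprK. Qed.

Fact repmod_scaleA a b v :
  repmod_scale a (repmod_scale b v) = repmod_scale (a * b) v.
Proof.
elim/quotW: a => x; elim/quotW: b => y.
by rewrite [_ * _]palg_mulE !repmod_scaleE.
Qed.
Fact repmod_scale1 : left_id 1 repmod_scale.
Proof. by move=> v; rewrite [LHS](repmod_scaleE (PCst 1)) /= scale1r. Qed.
Fact repmod_scaleDr : right_distributive repmod_scale +%R.
Proof. by elim/quotW=> x u v; rewrite !repmod_scaleE; apply: pactD. Qed.
Fact repmod_scaleDl v : {morph repmod_scale^~ v : a b / a + b}.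
Proof.
by elim/quotW=> x; elim/quotW=> y; rewrite [_ + _]palg_addE !repmod_scaleE.
Qed.
HB.instance Definition _ := GRing.Zmodule_isLmodule.Build (palg rels) (repmod rho)
  repmod_scaleA repmod_scale1 repmod_scaleDr repmod_scaleDl.

End Representation.

Section Restriction.
Variables (A B : pzRingType) (f : {rmorphism A -> B}).

Definition restr of {rmorphism A -> B} := fun M : lmodType B => M : Type.

Variable M : lmodType B.
HB.instance Definition _ := GRing.Zmodule.copy (restr f M) M.

Definition restr_scale (a : A) (m : restr f M) : restr f M := f a *: (m : M).

Fact restr_scaleA a b m :
  restr_scale a (restr_scale b m) = restr_scale (a * b) m.
Proof. by rewrite /restr_scale scalerA rmorphM. Qed.
Fact restr_scale1 : left_id 1 restr_scale.
Proof. by move=> m; rewrite /restr_scale rmorph1 scale1r. Qed.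
Fact restr_scaleDr : right_distributive restr_scale +%R.
Proof. by move=> a m m'; apply: scalerDr. Qed.
Fact restr_scaleDl m : {morph restr_scale^~ m : a b / a + b}.
Proof. by move=> a b; rewrite /restr_scale rmorphD; apply: scalerDl. Qed.
HB.instance Definition _ := GRing.Zmodule_isLmodule.Build A (restr f M)
  restr_scaleA restr_scale1 restr_scaleDr restr_scaleDl.

End Restriction.

(** The tensor product [B (x)_A M] along [f : A -> B]: formal finite sums
  [(b_1, m_1) + ... + (b_k, m_k)] modulo the usual bilinearity relations. *)

Inductive tens_eq (A B : comPzRingType) (f : {rmorphism A -> B}) (M : lmodType A) :
  seq (B * M) -> seq (B * M) -> Prop :=
| te_refl s : tens_eq f s s
| te_sym s t : tens_eq f s t -> tens_eq f t s
| te_trans s t u : tens_eq f s t -> tens_eq f t u -> tens_eq f s u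
| te_cat s s' t t' : tens_eq f s s' -> tens_eq f t t' -> tens_eq f (s ++ t) (s' ++ t')
| te_catC s t : tens_eq f (s ++ t) (t ++ s)
| te_0 m : tens_eq f [:: (0, m)] [::]
| te_Dl b b' m : tens_eq f [:: (b + b', m)] [:: (b, m); (b', m)]
| te_Dr b m m' : tens_eq f [:: (b, m + m')] [:: (b, m); (b, m')]
| te_Z b a m : tens_eq f [:: (b * f a, m)] [:: (b, a *: m)].

Section Tensor.
Variables (A B : comPzRingType) (f : {rmorphism A -> B}) (M : lmodType A).

Definition tens_eqb : rel (seq (B * M)) := fun s t => `[< tens_eq f s t >].

Fact tens_eqb_equiv : equiv_class_of tens_eqb.
Proof.
split=> [x|x y|y x z]; first exact/asboolP/te_refl.
  by apply/asboolP/asboolP; apply: te_sym.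
by move=> /asboolP xy /asboolP yz; apply/asboolP; apply: te_trans xy yz.
Qed.
Canonical tens_equiv := EquivRelPack tens_eqb_equiv.

Definition tens : Type := {eq_quot tens_equiv}.
HB.instance Definition _ := Choice.on tens.
HB.instance Definition _ := Quotient.on tens.
HB.instance Definition _ := EqQuotient.on tens.

Lemma tensP s t : tens_eq f s t <-> \pi_tens s = \pi_tens t.
Proof. by split=> [xy|/eqmodP/asboolP//]; apply/eqmodP/asboolP. Qed.

Lemma tens_reprK s : tens_eq f (repr (\pi_tens s)) s.
Proof. by apply/tensP; rewrite reprK. Qed.

Definition tens_lift (h : B * M -> B * M) (x : tens) : tens :=
  \pi_tens (map h (repr x)).

Definition tens_compat (h : B * M -> B * M) :=
  forall s t, tens_eq f s t -> tens_eq f (map h s) (map h t).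

Lemma tens_liftE h s : tens_compat h ->
  tens_lift h (\pi_tens s) = \pi_tens (map h s).
Proof. by move=> hP; apply/tensP/hP/tens_reprK. Qed.

Lemma tens_compatP (k : B) (g : {linear M -> M}) :
  tens_compat (fun p => (k * p.1, g p.2)).
Proof.
move=> s t; elim=> {s t} /=.
- by move=> s; apply: te_refl.
- by move=> s t _; apply: te_sym.
- by move=> s t u _ + _; apply: te_trans.
- by move=> s s' t t' _ hs _ ht; rewrite !map_cat; apply: te_cat.
- by move=> s t; rewrite !map_cat; apply: te_catC.
- by move=> m; rewrite mulr0; apply: te_0.
- by move=> b b' m; rewrite mulrDr; apply: te_Dl.
- by move=> b m m'; rewrite raddfD; apply: te_Dr.
- by move=> b a m; rewrite mulrA linearZ; apply: te_Z.
Qed.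

Definition tens_add (x y : tens) : tens := \pi_tens (repr x ++ repr y).
Definition tens_scale (k : B) : tens -> tens := tens_lift (fun p => (k * p.1, idfun p.2)).
Definition tens_opp : tens -> tens := tens_scale (- 1).

Lemma tens_addE s t : tens_add (\pi s) (\pi t) = \pi_tens (s ++ t).
Proof. by apply/tensP/te_cat; apply: tens_reprK. Qed.
Lemma tens_scaleE k s :
  tens_scale k (\pi s) = \pi_tens [seq (k * p.1, p.2) | p <- s].
Proof. by rewrite /tens_scale tens_liftE //; apply: (tens_compatP k idfun). Qed.

Fact tens_addA : associative tens_add.
Proof.
by elim/quotW=> x; elim/quotW=> y; elim/quotW=> z; rewrite !tens_addE catA.
Qed.
Fact tens_addC : commutative tens_add.
Proof. by elim/quotW=> x; elim/quotW=> y; rewrite !tens_addE; apply/tensP/te_catC. Qed.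
Fact tens_add0 : left_id (\pi_tens [::]) tens_add.
Proof. by elim/quotW=> x; rewrite tens_addE. Qed.

Lemma tens_scaleD k k' (s : seq (B * M)) :
  tens_eq f [seq ((k + k') * p.1, p.2) | p <- s]
    ([seq (k * p.1, p.2) | p <- s] ++ [seq (k' * p.1, p.2) | p <- s]).
Proof.
elim: s => [|[b m] s IHs] /=; first exact: te_refl.
rewrite mulrDl.
apply: (te_trans (te_cat (te_Dl f (k * b) (k' * b) m) IHs)) => /=.
apply: (te_cat (te_refl f [:: (k * b, m)])).
rewrite -cat_rcons -cat1s catA; apply: te_cat (te_refl _ _).
by rewrite -cats1; apply: te_catC.
Qed.

Lemma tens_scale0 (s : seq (B * M)) : tens_eq f [seq (0 * p.1, p.2) | p <- s] [::].
Proof.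
elim: s => [|[b m] s IHs] /=; first exact: te_refl.
by rewrite mul0r; apply: (te_cat (te_0 f m) IHs).
Qed.

Fact tens_addN : left_inverse (\pi_tens [::]) tens_opp tens_add.
Proof.
elim/quotW=> s; rewrite /tens_opp tens_scaleE tens_addE; apply/tensP.
have := tens_scaleD (- 1) 1 s; rewrite addNr.
have -> : [seq (1 * p.1, p.2) | p <- s] = s.
  by rewrite -[RHS]map_id; apply: eq_map => -[b m] /=; rewrite mul1r.
by move=> /te_sym/te_trans; apply; apply: tens_scale0.
Qed.

HB.instance Definition _ := GRing.isZmodule.Build tens
  tens_addA tens_addC tens_add0 tens_addN.

Fact tens_scaleA a b x : tens_scale a (tens_scale b x) = tens_scale (a * b) x.
Proof.
elim/quotW: x => s; rewrite !tens_scaleE -map_comp.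
by congr (\pi_tens _); apply: eq_map => p /=; rewrite mulrA.
Qed.
Fact tens_scale1 : left_id 1 tens_scale.
Proof.
elim/quotW=> s; rewrite tens_scaleE; congr (\pi_tens _).
by rewrite -[RHS]map_id; apply: eq_map => -[b m] /=; rewrite mul1r.
Qed.
Fact tens_scaleDr : right_distributive tens_scale +%R.
Proof.
move=> k; elim/quotW=> s; elim/quotW=> t.
by rewrite [_ + _]tens_addE !tens_scaleE [RHS]tens_addE map_cat.
Qed.
Fact tens_scaleDl x : {morph tens_scale^~ x : a b / a + b}.
Proof.
elim/quotW: x => s a b; rewrite !tens_scaleE [RHS]tens_addE.
exact/tensP/tens_scaleD.
Qed.
HB.instance Definition _ := GRing.Zmodule_isLmodule.Build B tens
  tens_scaleA tens_scale1 tens_scaleDr tens_scaleDl.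

Definition ptens (b : B) (m : M) : tens := \pi_tens [:: (b, m)].

Lemma ptensDr b m m' : ptens b (m + m') = ptens b m + ptens b m'.
Proof. by rewrite [RHS]tens_addE; apply/tensP/te_Dr. Qed.
Lemma ptensDl b b' m : ptens (b + b') m = ptens b m + ptens b' m.
Proof. by rewrite [RHS]tens_addE; apply/tensP/te_Dl. Qed.
Lemma ptensZ b c m : b *: ptens c m = ptens (b * c) m.
Proof. by rewrite [LHS]tens_scaleE. Qed.
Lemma ptensZr b a m : ptens b (a *: m) = f a *: ptens b m.
Proof. by rewrite ptensZ mulrC; apply/tensP/te_sym/te_Z. Qed.

Lemma tens_ind (P : tens -> Prop) :
  P 0 -> (forall b m x, P x -> P (ptens b m + x)) -> forall x, P x.
Proof.
move=> P0 PD; elim/quotW; elim=> [|[b m] s IHs]; first exact: P0.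
by have := PD b m _ IHs; rewrite [_ + _]tens_addE.
Qed.

Variable g : {linear M -> M}.

Definition tens_map : tens -> tens := tens_lift (fun p => (p.1, g p.2)).

Lemma tens_mapE s : tens_map (\pi s) = \pi_tens [seq (p.1, g p.2) | p <- s].
Proof.
rewrite /tens_map tens_liftE // => {}s t /(tens_compatP 1 g).
by do 2![rewrite (@eq_map _ _ _ (fun p => (p.1, g p.2))); last by move=> p; rewrite mul1r].
Qed.

Fact tens_map_is_linear : linear tens_map.
Proof.
move=> k; elim/quotW=> s; elim/quotW=> t.
rewrite [_ *: _]tens_scaleE [in LHS]/+%R /= tens_addE !tens_mapE.
by rewrite [_ *: _]tens_scaleE [RHS]tens_addE map_cat -!map_comp.
Qed.
HB.instance Definition _ := GRing.isLinear.Build B tens tens _ tens_map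
  tens_map_is_linear.

Lemma tens_map_ptens b m : tens_map (ptens b m) = ptens b (g m).
Proof. by rewrite tens_mapE. Qed.

End Tensor.

(** [pexpr2 c x y]: [y] is obtained from [x] by replacing every scalar of [A] by
  a scalar of [B] that corresponds to it under [c]. *)

Inductive pexpr2 (A B G : Type) (c : A -> B -> Prop) : pexpr A G -> pexpr B G -> Prop :=
| p2_cst a b : c a b -> pexpr2 c (PCst a) (PCst b)
| p2_gen g : pexpr2 c (PGen g) (PGen g)
| p2_add x x' y y' : pexpr2 c x x' -> pexpr2 c y y' -> pexpr2 c (x + y) (x' + y')
| p2_mul x x' y y' : pexpr2 c x x' -> pexpr2 c y y' -> pexpr2 c (x * y) (x' * y').

Definition rels_lift (A B G : Type) (c : A -> B -> Prop)
    (relsA : pexpr A G -> pexpr A G -> Prop)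
    (relsB : pexpr B G -> pexpr B G -> Prop) :=
  forall x y, relsB x y ->
  exists x' y', [/\ relsA x' y', pexpr2 c x' x & pexpr2 c y' y].

Section Transport.
Variables (A B : comPzRingType) (G : Type) (c : A -> B -> Prop).
Variables (relsA : pexpr A G -> pexpr A G -> Prop).
Variables (M : lmodType (palg relsA)) (W : lmodType B).
Variables (rho : G -> {linear W -> W}) (phi : M -> W).
Hypothesis phiD : {morph phi : m m' / m + m'}.
Hypothesis phi_gen : forall g m, phi (pgen relsA g *: m) = rho g (phi m).
Hypothesis phi_cst : forall a b m, c a b -> phi (pcst relsA a *: m) = b *: phi m.

Lemma pact2 x y m : pexpr2 c x y -> phi ((\pi x : palg relsA) *: m) = pact rho y (phi m).
Proof.
move=> xy; elim: xy m => {x y} [a b cab m|g m|x x' y y' _ IHx _ IHy m|x x' y y' _ IHx _ IHy m] /=.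
- exact: phi_cst.
- exact: phi_gen.
- by rewrite -IHx -IHy -phiD -scalerDl [(_ + _ in RHS)]palg_addE.
- by rewrite -IHy -IHx scalerA [(_ * _ in RHS)]palg_mulE.
Qed.

Lemma pact2_rel relsB x y m : rels_lift c relsA relsB -> relsB x y ->
  pact rho x (phi m) = pact rho y (phi m).
Proof.
move=> lift /lift[x' [y' [xy' /pact2<- /pact2<-]]].
by congr (phi (_ *: _)); apply/palgP/pe_rel.
Qed.

End Transport.

Section GeneratorAction.
Variables (A : comPzRingType) (G : Type) (rels : pexpr A G -> pexpr A G -> Prop).
Variable M : lmodType (palg rels).

Definition ground := restr (pcst rels) M.
HB.instance Definition _ := GRing.Lmodule.on ground.

Definition gen_act (g : G) (m : ground) : ground := pgen rels g *: (m : M).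

Lemma pcst_central a h : pcst rels a * h = h * pcst rels a.
Proof. by elim/quotW: h => x; rewrite [LHS]palg_mulE [RHS]palg_mulE; apply/palgP/pe_central. Qed.

Fact gen_act_is_linear g : linear (gen_act g).
Proof.
move=> a m m'; rewrite /gen_act [LHS]scalerDr; congr (_ + _).
by rewrite [LHS]scalerA -pcst_central -scalerA.
Qed.
HB.instance Definition _ g := GRing.isLinear.Build A ground ground _ (gen_act g)
  (gen_act_is_linear g).

End GeneratorAction.

(** The module [B (x)_A M] over the presented algebra over [B]; a generator [g]
  acts by [id (x) g]. *)

Section BaseChange.
Variables (A B : comPzRingType) (f : {rmorphism A -> B}) (G : Type).
Variables (relsA : pexpr A G -> pexpr A G -> Prop) (relsB : pexpr B G -> pexpr B G -> Prop).
Hypothesis relsAB : rels_lift (fun a b => f a = b) relsA relsB.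
Variable M : lmodType (palg relsA).

Definition bc_gen (g : G) : {linear tens f (ground M) -> tens f (ground M)} :=
  tens_map (gen_act g).

Fact bc_rel x y : relsB x y -> pact bc_gen x =1 pact bc_gen y.
Proof.
have lin z : linear (pact bc_gen z).
  exact: (pact_linear (PRep (rels := fun _ _ => False) (prep_fun := bc_gen) (fun _ _ => False_ind _))).
have linD z : {morph pact bc_gen z : u w / u + w}.
  by move=> u w; rewrite -{1}[u]scale1r lin scale1r.
have lin0 z : pact bc_gen z 0 = 0.
  by apply: (addIr (pact bc_gen z 0)); rewrite -linD !add0r.
move=> xy; elim/tens_ind=> [|b m t IHt]; first by rewrite !lin0.
rewrite !linD IHt; congr (_ + _).
apply: (@pact2_rel _ _ _ (fun a b => f a = b) relsA M _ bc_gen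
          (fun m : M => ptens f b (m : ground M))) relsAB xy.
- by move=> m1 m2; apply: ptensDr.
- by move=> g m1; rewrite /= tens_map_ptens.
- by move=> a b' m1 <-; rewrite -ptensZr.
Qed.

Definition base_change := repmod (PRep bc_rel).
HB.instance Definition _ := GRing.Lmodule.on base_change.

End BaseChange.

Section Quotient.
Variables (A : comPzRingType) (pi : A) (M : lmodType A).

Definition modpi_eqb : rel M := fun m m' => `[< exists d, m - m' = pi *: d >].

Fact modpi_eqb_equiv : equiv_class_of modpi_eqb.
Proof.
split=> [x|x y|y x z]; first by apply/asboolP; exists 0; rewrite subrr scaler0.
  by apply/asboolP/asboolP=> -[d xy]; exists (- d); rewrite scalerN -xy opprB.
move=> /asboolP[d xy] /asboolP[d' yz]; apply/asboolP; exists (d + d').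
by rewrite scalerDr -xy -yz addrA subrK.
Qed.
Canonical modpi_equiv := EquivRelPack modpi_eqb_equiv.

Definition modpi : Type := {eq_quot modpi_equiv}.
HB.instance Definition _ := Choice.on modpi.
HB.instance Definition _ := Quotient.on modpi.
HB.instance Definition _ := EqQuotient.on modpi.

Lemma modpiP m m' : (exists d, m - m' = pi *: d) <-> \pi_modpi m = \pi_modpi m'.
Proof. by split=> [xy|/eqmodP/asboolP//]; apply/eqmodP/asboolP. Qed.

Lemma modpi_reprK m : exists d, repr (\pi_modpi m) - m = pi *: d.
Proof. by apply/modpiP; rewrite reprK. Qed.

Definition modpi_add (x y : modpi) : modpi := \pi_modpi (repr x + repr y).
Definition modpi_opp (x : modpi) : modpi := \pi_modpi (- repr x).

Lemma modpi_addE m m' : modpi_add (\pi m) (\pi m') = \pi_modpi (m + m').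
Proof.
apply/modpiP; have [d dE] := modpi_reprK m; have [d' dE'] := modpi_reprK m'.
by exists (d + d'); rewrite scalerDr -dE -dE' opprD addrACA.
Qed.
Lemma modpi_oppE m : modpi_opp (\pi m) = \pi_modpi (- m).
Proof.
apply/modpiP; have [d dE] := modpi_reprK m.
by exists (- d); rewrite scalerN -dE opprD.
Qed.

Fact modpi_addA : associative modpi_add.
Proof. by elim/quotW=> x; elim/quotW=> y; elim/quotW=> z; rewrite !modpi_addE addrA. Qed.
Fact modpi_addC : commutative modpi_add.
Proof. by elim/quotW=> x; elim/quotW=> y; rewrite !modpi_addE addrC. Qed.
Fact modpi_add0 : left_id (\pi_modpi 0) modpi_add.
Proof. by elim/quotW=> x; rewrite modpi_addE add0r. Qed.
Fact modpi_addN : left_inverse (\pi_modpi 0) modpi_opp modpi_add.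
Proof. by elim/quotW=> x; rewrite modpi_oppE modpi_addE addNr. Qed.
HB.instance Definition _ := GRing.isZmodule.Build modpi
  modpi_addA modpi_addC modpi_add0 modpi_addN.

Lemma modpi_piD : {morph \pi_modpi : m m' / m + m'}.
Proof. by move=> m m'; rewrite [RHS]modpi_addE. Qed.
Lemma modpi_piMn k : {morph \pi_modpi : m / m *+ k}.
Proof.
by move=> m; elim: k => [|k IHk] //; rewrite !mulrS modpi_piD IHk.
Qed.

Definition modpi_map (g : M -> M) (x : modpi) : modpi := \pi_modpi (g (repr x)).

Lemma modpi_mapE (g : {linear M -> M}) m : modpi_map g (\pi m) = \pi_modpi (g m).
Proof.
apply/modpiP; have [d dE] := modpi_reprK m.
by exists (g d); rewrite -linearB dE linearZ.
Qed.

End Quotient.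

(** If [r] is a prime in the ideal [pi A], then [M / pi M] is an ['F_r]-module. *)

Section QuotientFp.
Variables (A : comPzRingType) (pi : A) (r : nat).
Hypotheses (r_pr : prime r) (r_pi : exists d, r%:R = pi * d).

Definition modpi_Fp of prime r & (exists d, r%:R = pi * d) := modpi pi.

Variable M : lmodType A.
HB.instance Definition _ := GRing.Zmodule.copy (modpi_Fp r_pr r_pi M) (modpi pi M).

Definition modpi_Fp_scale (b : 'F_r) (x : modpi_Fp r_pr r_pi M) : modpi_Fp r_pr r_pi M :=
  x *+ (b : nat).

Lemma modpi_FpMr (x : modpi_Fp r_pr r_pi M) : x *+ r = 0.
Proof.
elim/quotW: x => m; rewrite -[LHS]modpi_piMn; apply/modpiP.
have [d rE] := r_pi; exists (d *: m).
by rewrite subr0 scalerA -rE scaler_nat.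
Qed.

Lemma modpi_Fp_mod (x : modpi_Fp r_pr r_pi M) k : x *+ (k %% (Zp_trunc (pdiv r)).+2) = x *+ k.
Proof.
rewrite Fp_cast // [in RHS](divn_eq k r) mulrnDr mulnC mulrnA.
by rewrite modpi_FpMr mul0rn add0r.
Qed.

Fact modpi_Fp_scaleA a b x :
  modpi_Fp_scale a (modpi_Fp_scale b x) = modpi_Fp_scale (a * b) x.
Proof. by rewrite /modpi_Fp_scale /= modpi_Fp_mod mulnC mulrnA. Qed.
Fact modpi_Fp_scale1 : left_id 1 modpi_Fp_scale.
Proof. by move=> x; rewrite /modpi_Fp_scale /= ?modpi_Fp_mod. Qed.
Fact modpi_Fp_scaleDr : right_distributive modpi_Fp_scale +%R.
Proof. by move=> b x y; apply: mulrnDl. Qed.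
Fact modpi_Fp_scaleDl x : {morph modpi_Fp_scale^~ x : a b / a + b}.
Proof. by move=> a b; rewrite /modpi_Fp_scale /= modpi_Fp_mod mulrnDr. Qed.
HB.instance Definition _ := GRing.Zmodule_isLmodule.Build 'F_r (modpi_Fp r_pr r_pi M)
  modpi_Fp_scaleA modpi_Fp_scale1 modpi_Fp_scaleDr modpi_Fp_scaleDl.

Variable g : {linear M -> M}.
Definition modpi_Fp_map : modpi_Fp r_pr r_pi M -> modpi_Fp r_pr r_pi M := modpi_map g.

Fact modpi_Fp_map_is_linear : linear modpi_Fp_map.
Proof.
move=> b; elim/quotW=> x; elim/quotW=> y.
rewrite [b *: _](esym (modpi_piMn _ _ _)) [RHS]/GRing.add /=.
rewrite [in LHS]/GRing.add /= modpi_addE /modpi_Fp_map !modpi_mapE.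
by rewrite linearD raddfMn [b *: _](esym (modpi_piMn _ _ _)) modpi_addE.
Qed.
HB.instance Definition _ := GRing.isLinear.Build 'F_r _ _ _ modpi_Fp_map
  modpi_Fp_map_is_linear.

End QuotientFp.

(** A scalar of ['F_r] and a scalar of [A] correspond if they have the same
  class modulo [pi]. *)

Definition Fp_cor (A : comPzRingType) (pi : A) (r : nat) (a : A) (b : 'F_r) :=
  exists d, a - (b : nat)%:R = pi * d.

Section Reduction.
Variables (A : comPzRingType) (pi : A) (r : nat).
Hypotheses (r_pr : prime r) (r_pi : exists d, r%:R = pi * d).
Variables (G : Type) (relsA : pexpr A G -> pexpr A G -> Prop).
Variable relsF : pexpr 'F_r G -> pexpr 'F_r G -> Prop.
Hypothesis relsAF : rels_lift (@Fp_cor A pi r) relsA relsF.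
Variable M : lmodType (palg relsA).

Definition red_gen (g : G) :
    {linear modpi_Fp r_pr r_pi (ground M) -> modpi_Fp r_pr r_pi (ground M)} :=
  modpi_Fp_map (gen_act g).

Fact red_rel x y : relsF x y -> pact red_gen x =1 pact red_gen y.
Proof.
move=> xy; elim/quotW=> m.
apply: (@pact2_rel _ _ _ (@Fp_cor A pi r) relsA M _ red_gen
  (fun m : M => \pi_(modpi pi (ground M)) (m : ground M))) relsAF xy.
- by move=> m1 m2; apply: modpi_piD.
- by move=> g m1; rewrite /= [RHS]modpi_mapE.
- move=> a b m1 [d dE]; rewrite -[RHS]modpi_piMn; apply/modpiP.
  exists (d *: (m1 : ground M)); rewrite scalerA -dE scalerBl scaler_nat.
  by [].
Qed.

Definition reduction := repmod (PRep red_rel).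
HB.instance Definition _ := GRing.Lmodule.on reduction.

End Reduction.

(** The generators [L_1, ..., L_n] and [T_1, ..., T_(n-1)] are indexed from 0:
  [T_s] links [L_s] and [L_(s+1)], both as 1-based and as 0-based indices. *)

Inductive hecke_gen (n : nat) := HL of 'I_n | HT of 'I_n.-1.

Definition vint (R : pzRingType) (v : R) (m : nat) : R := \sum_(j < m) v ^+ (2 * j + 1).

Section Hecke.
Variables (R : comUnitRingType) (v : R) (n l : nat) (kappa : 'I_l -> nat).

Local Notation expr := (pexpr R (hecke_gen n)).
Local Notation L i := (PGen (HL i) : expr).
Local Notation T s := (PGen (HT s) : expr).

Inductive hecke_rel : expr -> expr -> Prop :=
| hecke_cyclotomic (i : 'I_n) : i = 0%N :> nat ->
    hecke_rel (\big[PMul/PCst 1]_(k < l) (L i + PCst (- vint v (kappa k)))%X) (PCst 0)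
| hecke_quadratic (s : 'I_n.-1) :
    hecke_rel ((T s + PCst v^-1) * (T s + PCst (- v))) (PCst 0)
| hecke_step (s : 'I_n.-1) (i j : 'I_n) : i = s :> nat -> j = s.+1 :> nat ->
    hecke_rel (L j) (T s * L i * T s + T s)
| hecke_LL (i j : 'I_n) : hecke_rel (L i * L j) (L j * L i)
| hecke_TT (s t : 'I_n.-1) : (s.+2 <= t)%N || (t.+2 <= s)%N ->
    hecke_rel (T s * T t) (T t * T s)
| hecke_braid (s t : 'I_n.-1) : t = s.+1 :> nat ->
    hecke_rel (T s * T t * T s) (T t * T s * T t)
| hecke_TL (s : 'I_n.-1) (i : 'I_n) : i <> s :> nat -> i <> s.+1 :> nat ->
    hecke_rel (T s * L i) (L i * T s).

Definition hecke : pzRingType := palg hecke_rel.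

End Hecke.

Section HeckeTransport.
Variables (A B : comUnitRingType) (c : A -> B -> Prop) (v : A) (w : B).
Hypotheses (c0 : c 0 0) (c1 : c 1 1).
Hypothesis cN : forall a b, c a b -> c (- a) (- b).
Hypothesis cD : forall a b a' b', c a b -> c a' b' -> c (a + a') (b + b').
Hypothesis cM : forall a b a' b', c a b -> c a' b' -> c (a * a') (b * b').
Hypotheses (cv : c v w) (cvV : c v^-1 w^-1).

Lemma vint_transport m : c (vint v m) (vint w m).
Proof.
apply: (big_ind2 c) => // j _; elim: (_ + _)%N => [|k IHk]; first by rewrite !expr0.
by rewrite !exprS; apply: cM.
Qed.

Lemma hecke_transport n l (kappa : 'I_l -> nat) :
  rels_lift c (@hecke_rel A v n l kappa) (@hecke_rel B w n l kappa).
Proof.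
have g x : @pexpr2 A B (hecke_gen n) c (PGen x) (PGen x) by apply: p2_gen.
move=> x y; case=> {x y}.
- move=> i i0; do 2!eexists; split; first exact: (hecke_cyclotomic v kappa i0).
    apply: (big_ind2 (pexpr2 c)); first exact: p2_cst.
      by move=> *; apply: p2_mul.
    by move=> k _; apply: p2_add => //; apply/p2_cst/cN/vint_transport.
  exact: p2_cst.
- move=> s; do 2!eexists; split; first exact: (hecke_quadratic v kappa s).
    by apply: p2_mul; apply: p2_add => //; apply: p2_cst => //; apply: cN.
  exact: p2_cst.
- move=> s i j si sj; do 2!eexists; split; first exact: (hecke_step v kappa si sj).
    exact: g.
  by apply: p2_add => //; do !apply: p2_mul => //.
- move=> i j; do 2!eexists; split; first exact: (hecke_LL v kappa i j); exact: p2_mul.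
- move=> s t st; do 2!eexists; split; first exact: (hecke_TT v kappa st); exact: p2_mul.
- move=> s t st; do 2!eexists; split; first exact: (hecke_braid v kappa st);
    by do !apply: p2_mul => //.
- move=> s i s0 s1; do 2!eexists; split; first exact: (hecke_TL v kappa s0 s1); exact: p2_mul.
Qed.

End HeckeTransport.

(** The subring [Z[z]] of a field. Its unit-ring structure is the inverse of the
  field, when that inverse lies in [Z[z]]. *)

Section Zadj.
Variables (F : fieldType) (z : F).

Definition in_Zadj : {pred F} :=
  fun x => `[< exists p : {poly int}, x = (map_poly intr p).[z] >].

Fact in_Zadj_subring : subring_closed in_Zadj.
Proof.
split; first by apply/asboolP; exists 1; rewrite rmorph1 hornerC.
  move=> _ _ /asboolP[p ->] /asboolP[q ->]; apply/asboolP; exists (p - q).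
  by rewrite rmorphB !hornerE.
move=> _ _ /asboolP[p ->] /asboolP[q ->]; apply/asboolP; exists (p * q).
by rewrite rmorphM !hornerE.
Qed.
HB.instance Definition _ := GRing.isSubringClosed.Build F in_Zadj in_Zadj_subring.

Record Zadj := MkZadj { Zadj_val : F; _ : Zadj_val \in in_Zadj }.
HB.instance Definition _ := [isSub for Zadj_val].
HB.instance Definition _ := [Choice of Zadj by <:].
HB.instance Definition _ := [SubChoice_isSubComNzRing of Zadj by <:].

Definition Zadj_unit : {pred Zadj} :=
  fun x => (Zadj_val x != 0) && ((Zadj_val x)^-1 \in in_Zadj).
Definition Zadj_inv (x : Zadj) : Zadj := insubd x (Zadj_val x)^-1.

Fact Zadj_mulVx : {in Zadj_unit, left_inverse 1 Zadj_inv *%R}.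
Proof.
move=> x /andP[x0 xV]; apply: val_inj.
by rewrite rmorphM rmorph1 /= /Zadj_inv (insubdK x xV) mulVf.
Qed.
Fact Zadj_unitPl (x y : Zadj) : y * x = 1 -> Zadj_unit x.
Proof.
move=> /(congr1 Zadj_val) yx1.
have {}yx1 : Zadj_val y * Zadj_val x = 1 by rewrite -[RHS]yx1.
have x0 : Zadj_val x != 0 by apply/eqP=> x0; move/eqP: yx1; rewrite x0 mulr0 eq_sym oner_eq0.
apply/andP; split=> //; have -> : (Zadj_val x)^-1 = Zadj_val y.
  by apply: (mulIf x0); rewrite mulVf.
exact: (valP y).
Qed.
Fact Zadj_inv_out : {in [predC Zadj_unit], Zadj_inv =1 id}.
Proof.
move=> x; rewrite inE => /nandP[|xV]; last by rewrite /Zadj_inv /insubd insubN.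
rewrite negbK => /eqP x0; apply: val_inj.
by rewrite /Zadj_inv val_insubd x0 invr0 /= x0; case: ifP.
Qed.
HB.instance Definition _ := GRing.ComNzRing_hasMulInverse.Build Zadj
  Zadj_mulVx Zadj_unitPl Zadj_inv_out.

Definition Zadj_emb : {rmorphism Zadj -> F} := val : Zadj -> F.

Fact Zadj_gen_subproof : z \in in_Zadj.
Proof. by apply/asboolP; exists 'X; rewrite map_polyX hornerX. Qed.
Definition Zadj_gen : Zadj := MkZadj Zadj_gen_subproof.

End Zadj.

Section RootOfUnity.
Variables (F : fieldType) (z : F) (r a : nat).
Hypotheses (r_pr : prime r) (a_gt0 : (0 < a)%N).
Hypothesis z_prim : (r ^ a)%N.-primitive_root z.

Local Notation zeta := (Zadj_gen z).
Local Notation pi := (1 - zeta).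

Lemma Zadj_gen_unit : zeta \is a GRing.unit.
Proof.
have e_gt0 := prim_order_gt0 z_prim.
apply/unitrP; exists (zeta ^+ (r ^ a).-1).
rewrite -exprS -exprSr prednK //.
by split; apply: val_inj; rewrite rmorphXn rmorph1 /= (prim_expr_order z_prim).
Qed.

(** [r] lies in the ideal [(1 - zeta)]: it is the value at [1] of the
  cyclotomic polynomial [\sum_(j < r) X ^+ (j * r ^ (a - 1))]. *)
Lemma prime_in_pi : exists d, r%:R = pi * d.
Proof.
pose w := zeta ^+ (r ^ a.-1).
have w1 : w != 1.
  apply/eqP=> /(congr1 val); rewrite rmorphXn rmorph1 /= => /eqP.
  rewrite -(prim_order_dvd z_prim) dvdn_Pexp2l ?prime_gt1 //.
  by rewrite -{1}(prednK a_gt0) ltnn.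
have wr : w ^+ r = 1.
  apply: val_inj; rewrite -exprM -expnSr prednK //.
  by rewrite rmorphXn rmorph1 /= (prim_expr_order z_prim).
have sum0 : \sum_(j < r) w ^+ j = 0.
  apply: val_inj; apply: (@mulfI _ (val (w - 1))); first by rewrite raddf_eq0 ?subr_eq0 //; exact: val_inj.
  by rewrite -!rmorphM -subrX1 wr subrr mulr0.
have pi_exp k : zeta ^+ k - 1 = pi * (- \sum_(j < k) zeta ^+ j).
  by rewrite subrX1 mulrN -mulNr opprB.
exists (\sum_(j < r) \sum_(i < r ^ a.-1 * j) zeta ^+ i).
have -> : r%:R = \sum_(j < r) (1 - w ^+ j).
  by rewrite sumrB sum0 subr0 sumr_const card_ord.
rewrite mulr_sumr; apply: eq_bigr => j _.
by rewrite /w -exprM -opprB pi_exp mulrN opprK.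
Qed.

Lemma Zadj_hecke_emb n l (kappa : 'I_l -> nat) :
  rels_lift (fun x y => Zadj_emb z x = y)
    (@hecke_rel _ zeta n l kappa) (@hecke_rel _ z n l kappa).
Proof.
apply: hecke_transport.
- exact: rmorph0.
- exact: rmorph1.
- by move=> x _ <-; rewrite rmorphN.
- by move=> x _ y _ <- <-; rewrite rmorphD.
- by move=> x _ y _ <- <-; rewrite rmorphM.
- by [].
- by rewrite rmorphV ?Zadj_gen_unit.
Qed.

Lemma Zadj_hecke_red n l (kappa : 'I_l -> nat) :
  rels_lift (@Fp_cor _ pi r)
    (@hecke_rel _ zeta n l kappa) (@hecke_rel _ (1 : 'F_r) n l kappa).
Proof.
have [d rE] := prime_in_pi.
have modr k : exists d', (k %% r)%:R - k%:R = pi * d'.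
  exists (- (d * (k %/ r)%:R)); rewrite [in X in _ - X](divn_eq k r) addnC natrD natrM.
  by rewrite opprD addrA subrr sub0r rE [RHS]mulrN mulrCA [d * _]mulrC.
have Fr : (Zp_trunc (pdiv r)).+2 = r := Fp_cast r_pr.
have modE k : (k %% (Zp_trunc (pdiv r)).+2 = k %% r)%N by rewrite Fr.
have cor (x : Zadj z) (b : 'F_r) k : b = (k %% r)%N :> nat -> (exists d', x - k%:R = pi * d') -> Fp_cor pi x b.
  move=> bE [d' xE]; have [d'' kE] := modr k; exists (d' - d'').
  by rewrite bE mulrBr -xE -kE opprB addrA subrK.
apply: hecke_transport.
- by exists 0; rewrite subrr mulr0.
- apply: (cor _ _ 1%N); last by exists 0; rewrite subrr mulr0.
  exact: modE.
- move=> x b [d' xE]; apply: (cor _ _ (r - b)%N).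
    by rewrite [LHS]modE; congr ((_ - _) %% _)%N.
  exists (- d' - d); have br : (b <= r)%N.
    by rewrite -[X in (_ <= X)%N](Fp_cast r_pr) ltnW.
  by rewrite natrB // mulrDr !mulrN -xE -rE !opprB addrCA addrA.
- move=> x b y b' [dx xE] [dy yE]; apply: (cor _ _ (b + b')%N); first exact: modE.
  by exists (dx + dy); rewrite mulrDr -xE -yE natrD opprD addrACA.
- move=> x b y b' [dx xE] [dy yE]; apply: (cor _ _ (b * b')%N); first exact: modE.
  exists (dx * y + (b : nat)%:R * dy).
  by rewrite mulrDr mulrA -xE mulrCA -yE natrM mulrBl mulrBr addrA subrK.
- apply: (cor _ _ 1%N); first exact: modE.
  by exists (-1); rewrite mulrN1 opprB.
- rewrite invr1; apply: (cor _ _ 1%N); first exact: modE.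
  by exists zeta^-1; rewrite mulrBl mul1r mulrV ?Zadj_gen_unit.
Qed.

(** [F (x)_Z[z] M] *)
Definition hecke_ext n l (kappa : 'I_l -> nat) (M : lmodType (hecke zeta n kappa)) :
  lmodType (hecke z n kappa) :=
  base_change (@Zadj_hecke_emb n l kappa) M.

(** [M / p M] for the principal ideal [p = (1 - zeta)], so that [p M = (1 - zeta) M] *)
Definition hecke_red n l (kappa : 'I_l -> nat) (M : lmodType (hecke zeta n kappa)) :
  lmodType (hecke (1 : 'F_r) n kappa) :=
  reduction r_pr prime_in_pi (@Zadj_hecke_red n l kappa) M.

Section Actions.
Variables (n l : nat) (kappa : 'I_l -> nat) (M : lmodType (hecke zeta n kappa)).
Implicit Types (m : M) (g : hecke_gen n).

Let clM (m : ground M) : modpi pi (ground M) := \pi m.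

Lemma hecke_ext_gen b m g :
  (pgen (hecke_rel z kappa) g : hecke z n kappa) *:
    (ptens (Zadj_emb z) b (m : ground M) : hecke_ext M) =
  ptens (Zadj_emb z) b (pgen (hecke_rel zeta kappa) g *: m : ground M).
Proof. by rewrite [LHS](repmod_scaleE (PGen g)); apply: tens_map_ptens. Qed.

Lemma hecke_ext_cst k b m :
  (pcst (hecke_rel z kappa) k : hecke z n kappa) *:
    (ptens (Zadj_emb z) b (m : ground M) : hecke_ext M) =
  ptens (Zadj_emb z) (k * b) (m : ground M).
Proof. by rewrite [LHS](repmod_scaleE (PCst k)); apply: ptensZ. Qed.

Lemma hecke_red_gen m g :
  (pgen (hecke_rel (1 : 'F_r) kappa) g : hecke (1 : 'F_r) n kappa) *:
    (clM m : hecke_red M) =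
  clM (pgen (hecke_rel zeta kappa) g *: m).
Proof. by rewrite [LHS](repmod_scaleE (PGen g)); apply: modpi_mapE. Qed.

Lemma hecke_red_cst k m :
  (pcst (hecke_rel (1 : 'F_r) kappa) k%:R : hecke (1 : 'F_r) n kappa) *:
    (clM m : hecke_red M) =
  clM (pcst (hecke_rel zeta kappa) k%:R *: m).
Proof.
rewrite !rmorph_nat !scaler_nat; symmetry.
by elim: k => [|k IHk] //; rewrite !mulrS -IHk; apply: modpi_piD.
Qed.

End Actions.

End RootOfUnity.

Definition finitely_generated (A : pzRingType) (M : lmodType A) : Prop :=
  exists (k : nat) (x : 'I_k -> M), forall m, exists c : 'I_k -> A,
    m = \sum_(i < k) c i *: x i.

Definition torsion_free (A : pzRingType) (M : lmodType A) : Prop :=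
  forall (a : A) (m : M), a *: m = 0 -> a = 0 \/ m = 0.

Definition Hom_nonzero (A : pzRingType) (M N : lmodType A) : Prop :=
  exists f : {linear M -> N}, exists m, f m <> 0.

(* Main.v *)
From HB Require Import structures.
Require Import Defs.
From mathcomp Require Import all_boot all_order all_algebra.
From mathcomp Require Import generic_quotient boolp reals complex.
From mathcomp Require Import ring.

(** Let A = Z[zeta] and pi = 1 - zeta. A finite family in an A-module has, up to
  a nonzero denominator, A-valued coordinates. Applied to N, they describe a
  nonzero homomorphism phi : M_C -> N_C by A-linear forms B_j : M -> C; applied
  to the A-span of the values of the B_j in C, they provide linear forms lambda
  from this span to A, and m |-> \sum_j lambda (B_j m) y_j is a nonzero
  homomorphism M -> N over A. Since pi ^+ (r ^ a) is divisible by r and A is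
  finite over Z, no nonzero element of N is divisible by all powers of pi, so
  the homomorphism can be divided by a power of pi until its image is not
  contained in pi N. Its reduction modulo pi is then nonzero. *)

Set Implicit Arguments.
Unset Strict Implicit.
Unset Printing Implicit Defensive.

Import GRing.Theory Num.Theory Pdiv.Ring Pdiv.RingMonic.
Local Open Scope ring_scope.
Local Open Scope quotient_scope.

(** * Spans of finite families *)

Definition in_span (A : pzRingType) (Q : lmodType A) (I : finType) (x : I -> Q)
    (w : Q) : Prop :=
  exists c : I -> A, w = \sum_i c i *: x i.

Section Span.
Variables (A : pzRingType) (Q : lmodType A) (I : finType) (x : I -> Q).

Lemma in_span0 : in_span x 0.
Proof. by exists (fun=> 0); rewrite big1 // => i _; rewrite scale0r. Qed.

Lemma in_span_linear a w w' : in_span x w -> in_span x w' -> in_span x (a *: w + w').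
Proof.
move=> [c ->] [c' ->]; exists (fun i => a * c i + c' i).
rewrite scaler_sumr -big_split; apply: eq_bigr => i _ /=.
by rewrite scalerDl scalerA.
Qed.

(** Linearity of [u] is asked only on the span, because the coordinates of [ex_coords] are arbitrary
    outside it. *)
Lemma span_linear_sum (u : Q -> A) (J : finType) (b : J -> A) (w : J -> Q) :
  (forall a w w', in_span x w -> in_span x w' -> u (a *: w + w') = a * u w + u w') ->
  (forall j, in_span x (w j)) -> u (\sum_j b j *: w j) = \sum_j b j * u (w j).
Proof.
move=> u_lin xw.
suff [_ ->] : in_span x (\sum_j b j *: w j) /\
  u (\sum_j b j *: w j) = \sum_j b j * u (w j) by [].
apply: (big_rec2 (fun v s => in_span x v /\ u v = s)).
  split; first exact: in_span0.
  have := u_lin 1 0 0 in_span0 in_span0; rewrite scaler0 addr0 mul1r => u0.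
  by apply: (addIr (u 0)); rewrite add0r -u0.
move=> j s v _ [xv <-]; split; first exact: in_span_linear.
exact: u_lin.
Qed.

End Span.

(** * Coordinates up to a denominator over an integral domain *)

Section Coordinates.
Variables (A : comPzRingType) (A_neq0 : (1 : A) <> 0) (A_dom : torsion_free A^o).
Variables (Q : lmodType A) (I : finType) (x : I -> Q).

Lemma mul_neq0 (a b : A) : a <> 0 -> b <> 0 -> a * b <> 0.
Proof. by move=> a0 b0 /(@A_dom a b)[]. Qed.

(** Greedy selection along the family: a vector independent of [y] is appended to [y]; otherwise a
    relation with coefficient [b <> 0] puts [b *: x i] in the span of [y], and [D] is multiplied by
    [b]. Indexing by [nat] lets [y] grow without casts. *)
Lemma ex_basis : exists (D : A) (d : nat) (y : nat -> Q),
  [/\ D <> 0,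
      forall c : nat -> A, \sum_(j < d) c j *: y j = 0 ->
        forall j, (j < d)%N -> c j = 0
    & forall i, exists c : nat -> A, D *: x i = \sum_(j < d) c j *: y j].
Proof.
suff [D [d [y [D0 ind gen]]]] : exists (D : A) (d : nat) (y : nat -> Q),
  [/\ D <> 0,
      forall c : nat -> A, \sum_(j < d) c j *: y j = 0 ->
        forall j, (j < d)%N -> c j = 0
    & forall i, i \in enum I ->
        exists c : nat -> A, D *: x i = \sum_(j < d) c j *: y j].
  by exists D, d, y; split=> // i; apply: gen; rewrite mem_enum.
elim: (enum I) => [|i s [D [d [y [D0 ind gen]]]]].
  by exists 1, 0%N, (fun=> 0); split.
have [dep|] := pselect (exists c : nat -> A, exists2 b, b <> 0 &
    \sum_(j < d) c j *: y j + b *: x i = 0).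
  have [c [b b0 /eqP]] := dep; rewrite addrC addr_eq0 => /eqP xE.
  exists (b * D), d, y; split=> //; first exact: mul_neq0.
  move=> i'; rewrite inE => /orP[/eqP->|/gen[c' cE]].
    exists (fun j => - (D * c j)); rewrite mulrC -scalerA xE scalerN scaler_sumr -sumrN.
    by apply: eq_bigr => j _; rewrite scaleNr scalerA.
  exists (fun j => b * c' j); rewrite -scalerA cE scaler_sumr.
  by apply: eq_bigr => j _; rewrite scalerA.
move=> indep; exists D, d.+1, (fun j => if (j < d)%N then y j else x i).
have sumE (c : nat -> A) :
    \sum_(j < d.+1) c j *: (if (j < d)%N then y j else x i) =
    \sum_(j < d) c j *: y j + c d *: x i.
  rewrite big_ord_recr /= ltnn; congr (_ + _).
  by apply: eq_bigr => j _; rewrite ltn_ord.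
split=> // [c|i'].
  rewrite (sumE c) => c0; have cd : c d = 0.
    by apply: contrapT => cd; apply: indep; exists c, (c d).
  move=> j; rewrite ltnS leq_eqVlt => /orP[/eqP->//|jd].
  by apply: ind => //; rewrite -[RHS]c0 cd scale0r addr0.
rewrite inE => /orP[/eqP->|/gen[c cE]].
  exists (fun j => if j == d then D else 0).
  rewrite (sumE (fun j => if j == d then D else 0)) eqxx big1 ?add0r // => j _.
  by rewrite (ltn_eqF (ltn_ord j)) scale0r.
exists (fun j => if (j < d)%N then c j else 0).
rewrite (sumE (fun j => if (j < d)%N then c j else 0)) ltnn scale0r addr0 cE.
by apply: eq_bigr => j _; rewrite ltn_ord.
Qed.

(** Coordinates are chosen pointwise; independence of [y] makes them unique on the span, hence
    linear there. *)
Lemma ex_coords : exists (D : A) (d : nat) (y : 'I_d -> Q) (co : 'I_d -> Q -> A),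
  [/\ D <> 0,
      forall c : 'I_d -> A, \sum_j c j *: y j = 0 -> forall j, c j = 0,
      forall w, in_span x w -> D *: w = \sum_j co j w *: y j
    & forall j a w w', in_span x w -> in_span x w' ->
        co j (a *: w + w') = a * co j w + co j w'].
Proof.
have [D [d [y [D0 ind gen]]]] := ex_basis.
have spanE w : in_span x w -> exists c : nat -> A, D *: w = \sum_(j < d) c j *: y j.
  case=> b ->; have /choice[c cE] := gen.
  exists (fun j => \sum_i b i * c i j); rewrite scaler_sumr.
  under eq_bigr do rewrite scalerA mulrC -scalerA cE scaler_sumr.
  rewrite exchange_big; apply: eq_bigr => j _; rewrite scaler_suml.
  by apply: eq_bigr => i _; rewrite scalerA.
have /choice[co coE] : forall w, exists c : nat -> A,
    in_span x w -> D *: w = \sum_(j < d) c j *: y j.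
  move=> w; have [/spanE[c cE]|nw] := pselect (in_span x w); first by exists c.
  by exists (fun=> 0).
exists D, d, y, (fun j w => co w j); split=> // [c c0 j|j a w w' xw xw'].
  (* [ind] speaks of sequences on [nat], so [c] is extended by zero beyond ['I_d]. *)
  have cE (k : 'I_d) : oapp c 0 (insub (k : nat)) = c k by rewrite valK.
  rewrite -cE; apply: (ind (fun k => oapp c 0 (insub k))) => //.
  by rewrite -[RHS]c0; apply: eq_bigr => k _; rewrite cE.
have xaw := in_span_linear a xw xw'.
apply/eqP; rewrite -subr_eq0; apply/eqP.
apply: (ind (fun j => co (a *: w + w') j - (a * co w j + co w' j))) => //.
under eq_bigr do rewrite scalerBl scalerDl -scalerA.
rewrite sumrB big_split -scaler_sumr /= -!coE // scalerDr.
by rewrite !scalerA mulrC subrr.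
Qed.

End Coordinates.

(** Every element of a presented algebra is the class of an expression, and induction on it leaves
    only generators and scalars to check. *)
Lemma palg_linear (A : comPzRingType) (G : Type)
    (rels : pexpr A G -> pexpr A G -> Prop) (M N : lmodType (palg rels)) (f : M -> N) :
  {morph f : m m' / m + m'} ->
  (forall g m, f (pgen rels g *: m) = pgen rels g *: f m) ->
  (forall a m, f (pcst rels a *: m) = pcst rels a *: f m) ->
  linear f.
Proof.
move=> fD fg fc h m m'; rewrite fD; congr (_ + _).
elim/quotW: h => x; elim: x m {m'} => [a|g|x IHx y IHy|x IHx y IHy] m.
- exact: fc.
- exact: fg.
- rewrite -[\pi_(_) _](palg_addE rels x y) [LHS](congr1 f (scalerDl _ _ _)).
  by rewrite fD IHx IHy -scalerDl.
- rewrite -[\pi_(_) _](palg_mulE rels x y) -[LHS](congr1 f (scalerA _ _ _)).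
  by rewrite IHx IHy scalerA.
Qed.

(** * Linear forms extended to a tensor product *)

Section TensorFunctional.
Variables (A B : comPzRingType) (f : {rmorphism A -> B}) (M : lmodType A).
Variable u : M -> A.
Hypothesis u_lin : forall a m m', u (a *: m + m') = a * u m + u m'.

Let uD m m' : u (m + m') = u m + u m'.
Proof. by rewrite -[m in LHS]scale1r u_lin mul1r. Qed.
Let u0 : u 0 = 0.
Proof. by apply: (addIr (u 0)); rewrite -uD !add0r. Qed.

(** The base change of [u] to [B]; [tens_funE] shows that the choice of representative does not
    matter. *)
Definition tens_fun (t : tens f M) : B := \sum_(p <- repr t) p.1 * f (u p.2).

Lemma tens_funE s : tens_fun (\pi s) = \sum_(p <- s) p.1 * f (u p.2).
Proof.
have := tens_reprK f s; rewrite /tens_fun; move: (repr _) => t.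
elim=> {t s}.
- by [].
- by move=> s t _ ->.
- by move=> s t v _ -> _ ->.
- by move=> s s' t t' _ IHs _ IHt; rewrite !big_cat /= IHs IHt.
- by move=> s t; rewrite !big_cat /= addrC.
- by move=> m; rewrite big_seq1 big_nil mul0r.
- by move=> b b' m; rewrite !big_cons !big_nil !addr0 mulrDl.
- by move=> b m m'; rewrite !big_cons !big_nil !addr0 /= uD rmorphD mulrDr.
- by move=> b a m; rewrite !big_seq1 /= -[a *: m]addr0 u_lin u0 addr0 rmorphM mulrA.
Qed.

Lemma tens_fun_ptens b m : tens_fun (ptens f b m) = b * f (u m).
Proof. by rewrite tens_funE big_seq1. Qed.

Lemma tens_funD : {morph tens_fun : t t' / t + t'}.
Proof.
elim/quotW=> s; elim/quotW=> t.
by rewrite [_ + _ in LHS]tens_addE !tens_funE big_cat.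
Qed.

Lemma tens_funZ b t : tens_fun (b *: t) = b * tens_fun t.
Proof.
elim/quotW: t => s; rewrite [_ *: _]tens_scaleE !tens_funE big_map mulr_sumr.
by apply: eq_bigr => p _; rewrite mulrA.
Qed.

End TensorFunctional.

(** * Descent of a nonzero homomorphism from a field to a subring *)

Section Descent.
Variables (A : comPzRingType) (F : fieldType) (f : {rmorphism A -> F}).
Hypothesis f_inj : injective f.
Variables (G : Type) (relsA : pexpr A G -> pexpr A G -> Prop).
Variables (relsF : pexpr F G -> pexpr F G -> Prop).
Hypothesis relsAF : rels_lift (fun a b => f a = b) relsA relsF.

(** Scalars of [F] act through [pcst] and generators through [tens_map (gen_act g)], so linearity
    over the presented algebra can be read on the bare tensor products. *)
Lemma base_change_hom (M N : lmodType (palg relsA))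
    (phi : {linear base_change relsAF M -> base_change relsAF N}) :
  [/\ {morph (phi : tens f (ground M) -> tens f (ground N)) : t t' / t + t'},
      forall b (t : tens f (ground M)),
        phi (b *: t) = b *: (phi t : tens f (ground N))
    & forall g (t : tens f (ground M)),
        phi (tens_map (gen_act g) t) = tens_map (gen_act g) (phi t)].
Proof.
split=> [t t'|b t|g t]; first exact: (linearD phi).
  have cstE (P : lmodType (palg relsA)) (v : tens f (ground P)) :
      b *: v = pcst relsF b *: (v : base_change relsAF P) :> tens f (ground P).
    by rewrite [RHS](repmod_scaleE (PCst b)).
  by rewrite !cstE; exact: (linearZZ phi).
have genE (P : lmodType (palg relsA)) (v : tens f (ground P)) :
    tens_map (gen_act g) v = pgen relsF g *: (v : base_change relsAF P)
    :> tens f (ground P).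
  by rewrite [RHS](repmod_scaleE (PGen g)).
by rewrite !genE; exact: (linearZZ phi).
Qed.

(** [F] may be larger than the fraction field of [A], so clearing denominators need not bring the
    coordinates of the values of [phi] back to [A]; a linear form on the finitely generated
    [A]-module that they span does. *)
Lemma base_change_descent (M N : lmodType (palg relsA)) :
  finitely_generated (ground M) -> finitely_generated (ground N) ->
  torsion_free (ground N) ->
  Hom_nonzero (base_change relsAF M) (base_change relsAF N) -> Hom_nonzero M N.
Proof.
move=> [p [x xE]] [q [w wE]] N_tf [phi0 [t0]].
have [] := base_change_hom phi0; move: (phi0 : _ -> _) t0 => {phi0}.
change (forall (phi : tens f (ground M) -> tens f (ground N))
    (t0 : tens f (ground M)),
  {morph phi : t t' / t + t'} -> (forall b t, phi (b *: t) = b *: phi t) ->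
  (forall g t, phi (tens_map (gen_act g) t) = tens_map (gen_act g) (phi t)) ->
  phi t0 <> 0 -> Hom_nonzero M N).
move=> phi t0 phiD phiZ phi_gen phi_t0.
have A_neq0 : (1 : A) <> 0.
  by move=> /(congr1 f) /eqP; rewrite rmorph0 rmorph1 oner_eq0.
have A_dom : torsion_free A^o.
  move=> a b /(congr1 f) /eqP; rewrite rmorph0 rmorphM mulf_eq0.
  by case/orP=> /eqP ab; [left | right]; apply: f_inj; rewrite ab rmorph0.
have [D [d [y [co [D0 y_ind coE co_lin]]]]] := ex_coords A_neq0 A_dom w.
have {}coE v : D *: v = \sum_j co j v *: y j by exact/coE/wE.
have co_sum k (J : finType) b (v : J -> ground N) :
    co k (\sum_j b j *: v j) = \sum_j b j * co k (v j).
  by apply: (@span_linear_sum _ _ _ w) => [|j]; [exact: co_lin|exact: wE].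
have {}co_lin j a v v' : co j (a *: v + v') = a * co j v + co j v'.
  by apply: co_lin; exact: wE.
pose u j := tens_fun (co j) : tens f (ground N) -> F.
have uD j : {morph u j : t t' / t + t'} := tens_funD (co_lin j).
have uZ j b t : u j (b *: t) = b * u j t := tens_funZ (co_lin j) b t.
have uE j b v : u j (ptens f b v) = b * f (co j v) := tens_fun_ptens f (co_lin j) b v.
have u0 j : u j 0 = 0 by have := uZ j 0 0; rewrite scaler0 mul0r.
have ptens0 v : ptens f 0 v = 0 :> tens f (ground N).
  by rewrite -(mul0r 1) -ptensZ scale0r.
(* The forms [u j] are coordinates on the extended module, with the same denominator [D]. *)
have tE t : f D *: t = \sum_j ptens f (u j t) (y j).
  elim/tens_ind: t => [|b m t IHt].
    rewrite scaler0 big1 // => j _.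
    by rewrite u0 ptens0.
  under eq_bigr do rewrite uD ptensDl.
  rewrite scalerDr big_split IHt /=; congr (_ + _).
  rewrite -ptensZr coE (big_morph _ (ptensDr f b) (id1 := 0)); last first.
    by rewrite -(scale0r (0 : ground N)) ptensZr rmorph0 scale0r.
  by apply: eq_bigr => j _; rewrite ptensZr ptensZ mulrC uE.
pose B j (m : ground M) := u j (phi (ptens f 1 m)) : restr f F^o.
have B_lin j a m m' : B j (a *: m + m') = a *: B j m + B j m'.
  by rewrite /B ptensDr phiD uD ptensZr phiZ uZ.
have [m0 m0E] : exists m, phi (ptens f 1 m) <> 0.
  apply: contrapT => phi0; apply: phi_t0; elim/tens_ind: t0 => [|b m t IHt].
    by rewrite -(scale0r 0) phiZ scale0r.
  rewrite phiD IHt addr0 -[b]mulr1 -ptensZ phiZ.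
  have [->|m0E] := pselect (phi (ptens f 1 m) = 0); first by rewrite scaler0.
  by case: phi0; exists m.
(* The values of the [B j] at the generators of [M] already span all values of the [B j] over
   [A]. *)
pose X (ji : 'I_d * 'I_p) := B ji.1 (x ji.2).
have XB j m : in_span X (B j m).
  have [c ->] := xE m; have B0 : B j 0 = 0.
    by have := B_lin j (-1) 0 0; rewrite scaler0 addr0 scaleN1r addNr.
  have BD : {morph B j : m m' / m + m'}.
    by move=> m1 m2; rewrite -[m1 in LHS]scale1r B_lin scale1r.
  rewrite (big_morph _ BD B0); elim/big_ind: _.
  - exact: in_span0.
  - by move=> v v'; rewrite -[v in v + _]scale1r; apply: in_span_linear.
  move=> i _; exists (fun ji => if ji == (j, i) then c i else 0).
  rewrite (bigD1 (j, i)) //= eqxx big1 => [|ji /negPf->]; last by rewrite scale0r.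
  by rewrite addr0 -[c i *: x i]addr0 B_lin B0 addr0.
have [D' [d' [y' [lam [D'0 _ lamE lam_lin]]]]] := ex_coords A_neq0 A_dom X.
(* [f D] is invertible in [F], so by [tE] a nonzero [phi (ptens f 1 m0)] has a nonzero
   coordinate. *)
have [j0 Bj0] : exists j, B j m0 <> 0.
  apply: contrapT => B0; apply: m0E.
  have fD : f D != 0 by apply/eqP=> fD0; apply: D0; apply: f_inj; rewrite fD0 rmorph0.
  rewrite -[LHS](scalerK fD) tE big1 ?scaler0 // => j _.
  have -> : u j (phi (ptens f 1 m0)) = 0.
    by apply: contrapT => uj; apply: B0; exists j.
  exact: ptens0.
have [i lam_i] : exists i, lam i (B j0 m0) <> 0.
  apply: contrapT => lam0; have := lamE _ (XB j0 m0); rewrite big1 => [|i _].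
    move=> /eqP; rewrite [_ *: _]/(f D' * _) mulf_eq0 => /orP[] /eqP// fD0.
    by apply: D'0; apply: f_inj; rewrite fD0 rmorph0.
  have -> : lam i (B j0 m0) = 0 by apply: contrapT => li; apply: lam0; exists i.
  by rewrite scale0r.
pose h (m : ground M) : ground N := \sum_j lam i (B j m) *: y j.
have h_lin a m m' : h (a *: m + m') = a *: h m + h m'.
  rewrite /h scaler_sumr -big_split; apply: eq_bigr => j _ /=.
  by rewrite B_lin lam_lin // scalerDl scalerA.
(* In coordinates a generator acts by a matrix with entries in [A], up to the factor [D]; an
   [A]-linear form such as [lam i] commutes with such a matrix. *)
have uk g k t : f D * u k (tens_map (gen_act g) t) =
    \sum_j f (co k (gen_act g (y j))) * u j t.
  rewrite -uZ -linearZ tE linear_sum (big_morph _ (uD k) (u0 k)).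
  by apply: eq_bigr => j _; rewrite /= tens_map_ptens uE mulrC.
have h_gen g m : h (gen_act g m) = gen_act g (h m).
  (* The matrix identity carries the factor [D], which torsion-freeness of [N] allows to cancel. *)
  suff /N_tf[] : D *: (h (gen_act g m) - gen_act g (h m)) = 0; [by []| |].
    by move/eqP; rewrite subr_eq0 => /eqP.
  apply/eqP; rewrite scalerBr subr_eq0; apply/eqP.
  rewrite /h scaler_sumr linear_sum scaler_sumr.
  transitivity (\sum_k \sum_j (co k (gen_act g (y j)) * lam i (B j m)) *: y k).
    apply: eq_bigr => k _; rewrite scalerA -scaler_suml; congr (_ *: _).
    rewrite -(span_linear_sum _ (lam_lin i)) //.
    (* The one-term sum expresses homogeneity of [lam i]. *)
    have := span_linear_sum (fun _ : 'I_1 => D) (lam_lin i)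
      (fun _ => XB k (gen_act g m)).
    rewrite !big_ord1 => <-; congr (lam i _).
    rewrite [LHS](_ : _ = f D * u k (phi (ptens f 1 (gen_act g m)))) //.
    by rewrite -tens_map_ptens phi_gen uk.
  rewrite exchange_big; apply: eq_bigr => j _ /=.
  rewrite linearZ scalerA mulrC -scalerA coE scaler_sumr.
  by apply: eq_bigr => k _; rewrite scalerA mulrC.
have h_linear : linear (h : M -> N).
  apply: palg_linear => [m m'|g m|a m].
  - by have := h_lin 1 m m'; rewrite !scale1r.
  - exact: h_gen.
  have := h_lin a m 0; have := h_lin (-1) 0 0.
  by rewrite scaler0 addr0 scaleN1r addNr => ->; rewrite !addr0.
pose hL : {linear M -> N} :=
  HB.pack (h : M -> N) (GRing.isLinear.Build _ _ _ _ _ h_linear).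
(* By independence of [y], [h m0 = 0] would kill every [lam i (B j m0)], in particular the one at
   [j0]. *)
exists hL, m0 => h0; apply: lam_i; exact: (y_ind (fun j => lam i (B j m0)) h0).
Qed.

End Descent.

(** * Arithmetic of [1 - zeta] in [Z[zeta]] *)

Lemma frobenius_mod (A : comPzRingType) (r : nat) (x y : A) : prime r ->
  exists d, (x + y) ^+ r = x ^+ r + y ^+ r + r%:R * d.
Proof.
case: r => // r r_pr.
(* The prime is now [r.+1]; it divides the inner binomial coefficients, and the quotients become the
   coefficients of [d]. *)
exists (\sum_(i < r) (x ^+ (r - i) * y ^+ i.+1) *+ ('C(r.+1, i.+1) %/ r.+1)).
rewrite exprDn big_ord_recl big_ord_recr /= /bump /=.
rewrite subn0 subnn bin0 binn !expr0 mulr1 mul1r !mulr1n addrA addrAC.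
congr (_ + _); rewrite mulr_sumr; apply: eq_bigr => i _.
rewrite mulr_natl -mulrnA add1n subSS divnK //.
by apply: prime_dvd_bin => //=; rewrite ltnS ltn_ord.
Qed.

Section Zadj.
Variables (F : fieldType) (z : F).
Local Notation A := (Zadj z).

Lemma Zadj_dom : torsion_free A^o.
Proof.
move=> a b /(congr1 val) /eqP; rewrite rmorphM /= mulf_eq0.
by case/orP=> /eqP ab; [left | right]; apply: (val_inj (ab : _ = val (0 : A))).
Qed.

Lemma Zadj_neq0 : (1 : A) <> 0.
Proof. by move=> /(congr1 val) /eqP; rewrite rmorph1 /= oner_eq0. Qed.

Variables (r a : nat).
Hypotheses (r_pr : prime r) (a_gt0 : (0 < a)%N).
Hypothesis z_prim : (r ^ a)%N.-primitive_root z.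
Local Notation zeta := (Zadj_gen z).
Local Notation pi := (1 - zeta).

Lemma pi_neq0 : pi <> 0.
Proof.
move=> /eqP; rewrite subr_eq0 => /eqP/(congr1 val) /esym /eqP; rewrite rmorph1 /=.
rewrite -[z]expr1 -(prim_order_dvd z_prim) dvdn1 -(expn0 r) eqn_exp2l ?prime_gt1 //.
by rewrite -leqn0 leqNgt a_gt0.
Qed.

(** Modulo [r], iterating Frobenius turns [(1 - zeta) ^+ (r ^ b)] into [1 - zeta ^+ (r ^ b)], which
    vanishes at [b = a]. *)
Lemma pi_exp_dvd : exists d, pi ^+ (r ^ a) = r%:R * d.
Proof.
have pi_exp b : exists d, pi ^+ (r ^ b) = 1 - zeta ^+ (r ^ b) + r%:R * d.
  elim: b => [|b [d IHb]]; first by exists 0; rewrite !expr1 mulr0 addr0.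
  rewrite expnSr exprM IHb exprM; move: (zeta ^+ _) => w {IHb}.
  have [d1 ->] := frobenius_mod (1 - w) (r%:R * d) r_pr.
  have [d2 ->] := frobenius_mod 1 (- w) r_pr.
  (* This gives [(- w) ^+ r = - w ^+ r] modulo [r] without separating the case [r = 2]. *)
  have [d3] := frobenius_mod w (- w) r_pr.
  rewrite subrr expr0n gtn_eqF ?prime_gt0 // => wE.
  exists (d2 - d3 + d ^+ r * r%:R ^+ r.-1 + d1).
  have rE : r%:R ^+ r = r%:R * r%:R ^+ r.-1 :> A by rewrite -exprS prednK ?prime_gt0.
  rewrite expr1n exprMn rE.
  rewrite -[LHS]subr0 [X in _ - X]wE.
  by move: (w ^+ r) ((- w) ^+ r) (d ^+ r) (r%:R ^+ _) => *; ring.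
have [d dE] := pi_exp a; exists d; rewrite dE -[RHS]add0r; congr (_ + _).
apply/eqP; rewrite subr_eq0; apply/eqP/val_inj.
by rewrite rmorphXn rmorph1 /= (prim_expr_order z_prim).
Qed.

(** Division by ['X^(r ^ a) - 1] is possible over the integers because it is monic, and the
    remainder has the same value at [z]. *)
Lemma Zadj_span (x : A) :
  in_span (fun i : 'I_(r ^ a) => zeta ^+ i : restr (intr : {rmorphism int -> A}) A^o) x.
Proof.
have /asboolP[p pE] := valP x.
pose q : {poly int} := 'X^(r ^ a) - 1.
have q_monic : q \is monic by exact: monicXnsubC (prim_order_gt0 z_prim).
have sq : size q = (r ^ a).+1 by exact: size_XnsubC (prim_order_gt0 z_prim).
have qz : (map_poly intr q : {poly F}).[z] = 0.
  by rewrite /q rmorphB /= map_polyXn rmorph1 !hornerE (prim_expr_order z_prim) subrr.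
exists (fun i : 'I_(r ^ a) => (rmodp p q)`_i : int); apply: val_inj; rewrite [LHS]pE.
rewrite {1}(rdivp_eq q_monic p) rmorphD rmorphM /= hornerD hornerM qz.
rewrite mulr0 add0r (@horner_coef_wide _ (r ^ a)).
  have -> : forall w : A, Zadj_val w = Zadj_emb z w by [].
  rewrite [RHS](raddf_sum (Zadj_emb z)); apply: eq_bigr => i _.
  rewrite coef_map [RHS](rmorphM (Zadj_emb z)) rmorphXn.
  by rewrite [in RHS](rmorph_int (Zadj_emb z)).
apply: leq_trans (size_poly _ _) _.
by rewrite -ltnS -sq ltn_rmodpN0 ?monic_neq0.
Qed.
End Zadj.

(** * Separatedness for the [pi]-adic filtration *)

Definition separated (A : comPzRingType) (pi : A) (N : lmodType A) : Prop :=
  forall n : N, (forall k, exists d, n = pi ^+ k *: d) -> n = 0.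

(** Coordinates are linear forms, so they inherit divisibility by every power of [pi] and vanish;
    then [D *: n = 0]. *)
Lemma separated_fg (A : comPzRingType) (pi : A) (N : lmodType A) :
  (1 : A) <> 0 -> torsion_free A^o -> separated (pi : A) A^o ->
  finitely_generated N -> torsion_free N -> separated pi N.
Proof.
move=> A_neq0 A_dom A_sep [q [w wE]] N_tf n nE.
have [D [d [y [co [D0 _ coE co_lin]]]]] := ex_coords A_neq0 A_dom w.
suff /N_tf[] : D *: n = 0 by [].
rewrite coE; last exact: wE.
rewrite big1 // => j _; suff -> : co j n = 0 by rewrite scale0r.
apply: A_sep => k; have [v ->] := nE k; exists (co j v).
have := span_linear_sum (fun _ : 'I_1 => pi ^+ k) (co_lin j) (fun _ => wE v).
by rewrite !big_ord1.
Qed.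

(** The exponent [|c|] suffices, since [r ^ |c|] exceeds [|c|]. *)
Lemma int_dvd_expn_eq0 (r : nat) (c : int) : (1 < r)%N ->
  (forall k, exists d, c = (r ^ k)%N%:Z * d) -> c = 0.
Proof.
move=> r_gt1 cE; apply/eqP; rewrite -absz_eq0; apply/negPn/negP.
rewrite -lt0n => c_gt0; have [d /(congr1 absz)] := cE `|c|%N; rewrite abszM /= => dE.
have : (r ^ `|c| <= `|c|)%N.
  by rewrite dvdn_leq // [X in (_ %| X)%N]dE dvdn_mulr.
by rewrite leqNgt ltn_expl.
Qed.

Section ZadjSeparated.
Variables (F : numFieldType) (z : F) (r a : nat).
Hypothesis r_pr : prime r.
Hypothesis z_prim : (r ^ a)%N.-primitive_root z.
Local Notation A := (Zadj z).
Local Notation pi := (1 - Zadj_gen z).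

(** By [pi_exp_dvd], an element divisible by all powers of [pi] is divisible by all powers of [r],
    and so are its finitely many integer coordinates. *)
Lemma Zadj_separated : separated pi A^o.
Proof.
move=> x xE.
have int_dom : torsion_free (int : comPzRingType)^o.
  by move=> b c /eqP; rewrite mulf_eq0 => /orP[]/eqP; [left | right].
have [D [d [y [co [D0 _ coE co_lin]]]]] :=
  ex_coords (elimN eqP (oner_neq0 int)) int_dom
    (fun i : 'I_(r ^ a) =>
       Zadj_gen z ^+ i : restr (intr : {rmorphism int -> A}) A^o).
have [e eE] := pi_exp_dvd r_pr z_prim.
have {}coE := coE _ (Zadj_span z_prim _).
have {}co_lin j := co_lin j _ _ _ (Zadj_span z_prim _) (Zadj_span z_prim _).
have coZ j c v : co j (c *: v) = c * co j v.
  by rewrite -[c in LHS](subrK 1) scalerDl scale1r co_lin mulrBl mul1r subrK.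
have co0 j : co j x = 0.
  apply: (int_dvd_expn_eq0 (prime_gt1 r_pr)) => k.
  have [v vE] := xE (r ^ a * k)%N; pose w : A := e ^+ k * v.
  exists (co j w); rewrite -coZ; congr (co j _).
  by rewrite vE exprM eE exprMn -[LHS]mulrA -natrX.
have /Zadj_dom[D0'|//] : D%:~R * x = 0 :> A.
  by rewrite [LHS]coE big1 // => j _; rewrite co0 scale0r.
(* Characteristic zero keeps the integer denominator [D] nonzero in [F]. *)
case: D0; apply/eqP; rewrite -(intr_eq0 F).
have -> : D%:~R = val (D%:~R : A) by rewrite [RHS](rmorph_int (Zadj_emb z)).
by rewrite D0'.
Qed.
End ZadjSeparated.

(** * Dividing a homomorphism by powers of [pi] *)

Section PrimitiveHom.
Variables (A : comPzRingType) (G : Type) (rels : pexpr A G -> pexpr A G -> Prop).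
Variables (M N : lmodType (palg rels)) (pi : A).
Hypotheses (pi_neq0 : pi <> 0) (N_tf : torsion_free (ground N)).

Let pi_inj (v w : ground N) : pi *: v = pi *: w -> v = w.
Proof.
move/eqP; rewrite -subr_eq0 -scalerBr => /eqP/N_tf[] // /eqP.
by rewrite subr_eq0 => /eqP.
Qed.

(** Torsion-freeness makes the quotient by [pi] unique, so the pointwise choice is linear. *)
Lemma hom_div (f : {linear M -> N}) :
  (forall m, exists v : ground N, (f m : ground N) = pi *: v) ->
  exists g : {linear M -> N}, forall m, (f m : ground N) = pi *: (g m : ground N).
Proof.
move=> /choice[g gE].
have g_linear : linear (g : M -> N).
  apply: palg_linear => [m m'|x m|a m]; apply: pi_inj; rewrite -gE.
  - by rewrite scalerDr -!gE; apply: (linearD f).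
  - have genZ : gen_act x (pi *: g m) = pi *: gen_act x (g m) by exact: linearZ.
    by rewrite -[RHS]genZ -gE; exact: (linearZZ f).
  have -> : pcst rels a *: g m = a *: g m :> ground N by [].
  by rewrite scalerA mulrC -scalerA -gE; exact: (linearZZ f).
pose gL : {linear M -> N} :=
  HB.pack (g : M -> N) (GRing.isLinear.Build _ _ _ _ _ g_linear).
by exists gL => m; exact: gE.
Qed.

(** If every homomorphism had its image in [pi N], division could be repeated forever, and a nonzero
    value [f m] would be divisible by all powers of [pi]. *)
Lemma ex_primitive_hom : separated pi (ground N) -> Hom_nonzero M N ->
  exists (f : {linear M -> N}) (m : M),
    ~ exists v : ground N, (f m : ground N) = pi *: v.
Proof.
move=> N_sep [f [m fm]]; apply: contrapT => prim.
have div (g : {linear M -> N}) m' : exists v : ground N, (g m' : ground N) = pi *: v.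
  by apply: contrapT => gm; apply: prim; exists g, m'.
apply/fm/N_sep => k.
suff [g ->] : exists g : {linear M -> N},
    (f m : ground N) = pi ^+ k *: (g m : ground N) by exists (g m).
elim: k => [|k [g ->]]; first by exists f; rewrite expr0 scale1r.
have [g' g'E] := hom_div (div g).
by exists g'; rewrite g'E scalerA -exprSr.
Qed.

End PrimitiveHom.

(** * Reduction of a homomorphism modulo [pi] *)

Section ReductionHom.
Variables (A : comPzRingType) (pi : A) (r : nat).
Hypotheses (r_pr : prime r) (r_pi : exists d, r%:R = pi * d).
Variables (G : Type) (relsA : pexpr A G -> pexpr A G -> Prop).
Variable relsF : pexpr 'F_r G -> pexpr 'F_r G -> Prop.
Hypothesis relsAF : rels_lift (@Fp_cor A pi r) relsA relsF.

Lemma reduction_hom (M N : lmodType (palg relsA)) (f : {linear M -> N}) (m : M) :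
  ~ (exists v : ground N, (f m : ground N) = pi *: v) ->
  Hom_nonzero (reduction r_pr r_pi relsAF M) (reduction r_pr r_pi relsAF N).
Proof.
move=> fm.
have f_lin : linear (f : ground M -> ground N).
  move=> a m1 m2; rewrite [LHS](linearD f); congr (_ + _).
  exact: (linearZZ f).
pose fL : {linear ground M -> ground N} :=
  HB.pack (f : ground M -> ground N) (GRing.isLinear.Build _ _ _ _ _ f_lin).
pose g (x : modpi pi (ground M)) : modpi pi (ground N) :=
  \pi_(modpi pi (ground N)) (fL (repr x)).
have gE v : g (\pi v) = \pi_(modpi pi (ground N)) (fL v).
  apply/modpiP; have [d dE] := modpi_reprK pi v; exists (fL d).
  by rewrite -linearB dE linearZ.
have gD : {morph g : x y / x + y}.
  elim/quotW=> x; elim/quotW=> y.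
  by rewrite -modpi_piD !gE linearD modpi_piD.
have g_linear : linear
    (g : reduction r_pr r_pi relsAF M -> reduction r_pr r_pi relsAF N).
  apply: palg_linear => [|x v|b v]; first exact: gD.
    rewrite [_ *: v](repmod_scaleE (PGen x)) [RHS](repmod_scaleE (PGen x)) /=.
    elim/quotW: v => v.
    rewrite gE /modpi_Fp_map !modpi_mapE gE.
    by congr (\pi _); exact: (linearZZ f).
  (* A scalar of ['F_r] is a natural multiple of [1], so additivity of [g] is enough. *)
  rewrite -[b]natr_Zp rmorph_nat !scaler_nat.
  have g0 : g 0 = 0 by apply: (addIr (g 0)); rewrite -gD !add0r.
  by elim: (b : nat) => [|k IHk]; rewrite ?mulr0n ?mulrS ?gD ?IHk.
pose gL : {linear reduction r_pr r_pi relsAF M -> reduction r_pr r_pi relsAF N} :=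
  HB.pack (g : reduction r_pr r_pi relsAF M -> reduction r_pr r_pi relsAF N)
    (GRing.isLinear.Build _ _ _ _ _ g_linear).
exists gL, (\pi_(modpi pi (ground M)) m) => /= gm.
apply: fm; have : \pi_(modpi pi (ground N)) (fL m) = \pi_(modpi pi (ground N)) 0.
  by rewrite -gE; exact: gm.
by move=> /modpiP[v]; rewrite subr0 => fm; exists v.
Qed.

End ReductionHom.

(** Finite generation and torsion-freeness are meant over [Z[zeta]], hence [ground]. For [M], finite
    generation makes the span of coordinate values finite; for [N], the two conditions give
    coordinates, cancellation of denominators and [pi]-adic separatedness. *)
Theorem corollary4p2 (R : realType) (r a n l : nat) (kappa : 'I_l -> nat)
    (zeta : R[i])
    (r_pr : prime r) (a_gt0 : (0 < a)%N) (n_gt0 : (0 < n)%N) (l_gt0 : (0 < l)%N)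
    (kappa_lt : forall k, (kappa k < r ^ a)%N)
    (zeta_prim : (r ^ a)%N.-primitive_root zeta)
    (M N : lmodType (hecke (Zadj_gen zeta) n kappa))
    (M_fg : finitely_generated (ground M))
    (N_fg : finitely_generated (ground N))
    (N_tf : torsion_free (ground N)) :
  Hom_nonzero (hecke_ext zeta_prim M) (hecke_ext zeta_prim N) ->
  Hom_nonzero (hecke_red r_pr a_gt0 zeta_prim M) (hecke_red r_pr a_gt0 zeta_prim N).
Proof.
move=> /(base_change_descent val_inj M_fg N_fg N_tf).
have N_sep := separated_fg (@Zadj_neq0 _ zeta) (@Zadj_dom _ zeta)
  (Zadj_separated r_pr zeta_prim) N_fg N_tf.
move=> /(ex_primitive_hom (pi_neq0 r_pr a_gt0 zeta_prim) N_tf N_sep)[f [m fm]].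
exact: reduction_hom fm.
Qed.
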